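(* Let $k,d,\lambda$ be positive integers with $d\ge\lambda$, $k\ge\lambda+1$ and $\alpha(d,\lambda)<1$. Then $$z(k,d,\lambda)\le\zeta(k,d,\lambda)\le Z(k,d,\lambda),$$ where $$z(k,d,\lambda)=(d-\lambda+1)+\max_{\substack{j\in\{\lambda+1,\ldots,d-\lambda+2\}\\ j+\lambda\text{ odd}}}\left(\left\lfloor\frac{k-1}{\beta(\lambda,j)}\right\rfloor\cdot j+(k-1)_{\bmod \beta(\lambda,j)}\right),\qquad \beta(\lambda,j)=\frac{j+\lambda-1}{2},$$ and $$Z(k,d,\lambda)=(d-\lambda+1)+\left\lfloor(2-\alpha(d,\lambda))(k-1)\right\rfloor.$$
   Context: $(k-1)_{\bmod \beta}$ denotes the remainder of $k-1$ upon division by $\beta$. For a finite set $X\subset\mathbb{R}^d$, a $(d-\lambda)$-plane $L$ is a complete Kneser $(d-\lambda)$-transversal of $X$ if $L$ intersects $\operatorname{conv}(K)$ for every $k$-element subset $K\subseteq X$ and $L$ contains $d-\lambda+1$ points of $X$. The moment curve is $\gamma(t)=(t,t^2,\ldots,t^d)$; a cyclic polytope with $n$ vertices is the convex hull of $\{\gamma(t_1),\ldots,\gamma(t_n)\}$ for reals $t_1<\cdots<t_n$ (its combinatorial type does not depend on the $t_i$). $\zeta(k,d,\lambda)$ is the maximum number of vertices a cyclic polytope in $\mathbb{R}^d$ can have so that its vertex set has a complete Kneser $(d-\lambda)$-transversal to the convex hulls of its $k$-subsets of vertices. $\alpha(d,\lambda)=\frac{\lambda-1}{\lceil d/2\rceil}$.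 *)

(* Defs.v *)
From HB Require Import structures.
From mathcomp Require Import all_boot all_order all_algebra.
From mathcomp Require Import finmap.
From mathcomp Require Import reals.

Set Implicit Arguments.
Unset Strict Implicit.
Unset Printing Implicit Defensive.

Import Order.TTheory GRing.Theory Num.Theory.
Local Open Scope ring_scope.
Local Open Scope fset_scope.

Section Transversals.
Variables (R : realType) (d : nat).
Implicit Types (x : 'rV[R]_d) (K X : {fset 'rV[R]_d}).

Definition in_conv K x : Prop :=
  exists w : 'rV[R]_d -> R,
    [/\ forall p, p \in K -> 0 <= w p,
        \sum_(p <- K) w p = 1
      & x = \sum_(p <- K) w p *: p].

Definition is_plane (m : nat) (L : 'rV[R]_d -> Prop) : Prop :=
  exists (a : 'rV[R]_d) (V : {vspace 'rV[R]_d}),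
    \dim V = m /\ forall x, L x <-> x - a \in V.

(* By general position, a (d - l)-plane never contains more than d - l + 1
   points of the moment curve when 0 < l <= d, so "at least" and "exactly"
   d - l + 1 points mean the same for the sets X considered below. *)
Definition complete_kneser_transversal (k l : nat) X
    (L : 'rV[R]_d -> Prop) : Prop :=
  [/\ is_plane (d - l) L,
      forall K, K `<=` X -> #|` K| = k -> exists x, in_conv K x /\ L x
    & exists Y, [/\ Y `<=` X, #|` Y| = (d - l).+1 & forall y, y \in Y -> L y]].

Definition moment_curve (t : R) : 'rV[R]_d := \row_(i < d) t ^+ i.+1.

(* The polytope is represented by its vertex set.  For d = 1 the curve is a
   line and the points t_1 < ... < t_n themselves are taken as vertices. *)
Definition cyclic_polytope_vertices (n : nat) X : Prop :=
  exists t : 'I_n -> R,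
    (forall i j : 'I_n, (i < j)%N -> t i < t j) /\
    X = [fset moment_curve (t i) | i in 'I_n].

Definition admits_transversal (k l n : nat) : Prop :=
  exists X, cyclic_polytope_vertices n X /\
    exists L, complete_kneser_transversal k l X L.

End Transversals.

Definition is_zeta (R : realType) (k d l zeta : nat) : Prop :=
  admits_transversal R d k l zeta /\
  forall n, admits_transversal R d k l n -> (n <= zeta)%N.

Definition alpha (d l : nat) : rat := (l%:R - 1) / (uphalf d)%:R.

Definition beta (l j : nat) : nat := ((j + l - 1) %/ 2)%N.

(* If 0 < l <= d, then alpha d l < 1 means 2 * l <= d + 1, so j = l + 1 is
   in the range of the maximum. *)
Definition z_bound (k d l : nat) : nat :=
  ((d - l + 1) +
   \max_(l + 1 <= j < (d - l + 2).+1 | odd (j + l))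
     ((k - 1) %/ beta l j * j + (k - 1) %% beta l j))%N.

Definition Z_bound (k d l : nat) : int :=
  (d - l + 1)%N%:Z + Num.floor ((2 - alpha d l) * (k%:R - 1)).

(* Main.v *)
Require Import Defs.
From mathcomp Require Import all_boot all_order all_algebra.
From mathcomp Require Import finmap.
From mathcomp Require Import boolp reals.
From mathcomp Require Import zify ring.

(** An affine functional on R^d restricted to the moment curve is a polynomial
    of degree at most d.  Let S be the d - l + 1 curve parameters of points of
    X lying on the plane L, so that L is the affine span of these points.

    Upper bound.  Put h = uphalf d, c = 2h - l + 1, e = h - l + 1, and regard S
    (with one parameter beyond all points of X added when d is odd) as c
    cyclically ordered cut points.  For each shift i discard the points of X
    in the cyclic gaps i, i + 2, ..., i + 2(e - 1).  The polynomial
    prod_{s in S} (X - s) times the product of X - s over the l - 1 cut points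
    not adjacent to a discarded gap vanishes on S and has constant sign on the
    remaining points, so at most k - 1 points remain.  Each point is discarded
    for at most e shifts; summing over i gives h N <= c (k - 1) for the number
    N of points of X off L.

    Lower bound.  Write k - 1 = beta q + r.  Cut the line by S into blocks, put
    q points in each of the first j blocks and r extra points in the first one.
    A k-subset avoiding S meets at least beta + 1 blocks, hence contains l + 1
    points lying in blocks of alternating parity.  The divided difference on
    these points together with S is an affine dependency among d + 2 points of
    the curve whose coefficients have a constant sign on the l + 1 points; it
    exhibits a common point of L and the hull of the k-subset. *)

Set Implicit Arguments.
Unset Strict Implicit.
Unset Printing Implicit Defensive.
Import Order.TTheory GRing.Theory Num.Theory.
Local Open Scope ring_scope.

(** * Affine functionals on the moment curve *)

Section MomentCurve.
Variables (R : realType) (d : nat).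
Implicit Types (f : {poly R}) (S : seq R).
Local Notation gamma := (@moment_curve R d).

(* The linear part of the affine functional on R^d that restricts to [f] on
   the moment curve; its constant term is [f`_0]. *)
Definition poly_lin f (x : 'rV[R]_d) : R := (x *m \col_i f`_i.+1) 0 0.

Lemma poly_linE f x : poly_lin f x = \sum_(i < d) f`_i.+1 * x 0 i.
Proof. by rewrite /poly_lin mxE; apply: eq_bigr => i _; rewrite mxE mulrC. Qed.

Lemma poly_linB f x y : poly_lin f (x - y) = poly_lin f x - poly_lin f y.
Proof. by rewrite /poly_lin mulmxBl !mxE. Qed.

Lemma poly_lin_sum f I (r : seq I) (w : I -> R) (F : I -> 'rV[R]_d) :
  poly_lin f (\sum_(i <- r) w i *: F i) = \sum_(i <- r) w i * poly_lin f (F i).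
Proof.
rewrite /poly_lin mulmx_suml summxE; apply: eq_bigr => i _.
by rewrite -scalemxAl mxE.
Qed.

Lemma poly_lin_moment f t :
  (size f <= d.+1)%N -> poly_lin f (gamma t) = f.[t] - f`_0.
Proof.
move=> sf; rewrite poly_linE (horner_coef_wide _ sf) big_ord_recl expr0 mulr1.
by rewrite addrC addKr; apply: eq_bigr => i _; rewrite mxE.
Qed.

Lemma poly_lin_momentB f s t : (size f <= d.+1)%N ->
  poly_lin f (gamma s - gamma t) = f.[s] - f.[t].
Proof.
by move=> sf; rewrite poly_linB !poly_lin_moment // opprB addrA subrK.
Qed.

Lemma moment_curve_inj : (0 < d)%N -> injective gamma.
Proof.
by move=> d0 x y /rowP/(_ (Ordinal d0)); rewrite !mxE !expr1.
Qed.

Lemma size_prodXsubC_cond (P : pred R) S :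
  size (\prod_(y <- S | P y) ('X - y%:P)) = (count P S).+1.
Proof. by rewrite -big_filter size_prod_XsubC size_filter. Qed.

(** The product of [X - y] over all listed parameters except one, [si], has degree at most [d]. Its
    functional kills every difference but the one at [si], which isolates the coefficient [c i]. *)
Lemma free_moment_diff s0 S : uniq (s0 :: S) -> (size S <= d)%N ->
  free [seq gamma s - gamma s0 | s <- S].
Proof.
move=> uS sS.
rewrite (_ : [seq _ | s <- S] =
  [tuple of [seq gamma s - gamma s0 | s <- in_tuple S]]) //.
apply/freeP => c c0 i.
have iS : (i < size S)%N by [].
pose si := S`_i.
pose f := \prod_(y <- s0 :: S | y != si) ('X - y%:P).
have siS : si \in S by exact: mem_nth.
have sif : (size f <= d.+1)%N.
  rewrite size_prodXsubC_cond ltnS.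
  have := count_predC (pred1 si) (s0 :: S).
  have -> : count (pred1 si) (s0 :: S) = 1%N.
    by rewrite (count_uniq_mem _ uS) inE siS orbT.
  by rewrite /= => -[H]; move: sS; rewrite -H.
have fv y : y \in s0 :: S -> y != si -> f.[y] = 0.
  move=> yS ny; rewrite /f horner_prod (big_rem y) //= ny !hornerE subrr.
  by rewrite mul0r.
have f0 : f.[s0] = 0.
  by apply: fv; rewrite ?mem_head //; case/andP: uS => + _; apply: contraNneq => ->.
have := congr1 (poly_lin f) c0.
rewrite poly_lin_sum (bigD1 i) //= big1 => [|j ji].
  rewrite (nth_map 0) // poly_lin_momentB // f0 subr0.
  rewrite addr0 /poly_lin mul0mx mxE => /eqP; rewrite mulf_eq0 => /orP[/eqP //|].
  move=> f1; exfalso; move: f1; apply/negP.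
  rewrite /f horner_prod prodf_seq_neq0; apply/allP => y yS; apply/implyP => ny.
  by rewrite !hornerE subr_eq0 eq_sym.
rewrite (nth_map 0) // poly_lin_momentB // f0 fv ?subrr ?mulr0 //.
  by rewrite inE mem_nth ?orbT.
rewrite /si nth_uniq //; first by case/andP: uS.
Qed.

(** By freeness and dimension the differences span the whole direction space of [L], so an affine
    functional vanishing at the chosen points vanishes on all of [L]. *)
Lemma poly_lin_plane f (L : 'rV[R]_d -> Prop) s0 S x : is_plane (size S) L ->
    uniq (s0 :: S) -> (size S <= d)%N -> (size f <= d.+1)%N ->
    (forall s, s \in s0 :: S -> L (gamma s) /\ f.[s] = 0) ->
  L x -> poly_lin f x = - f`_0.
Proof.
move=> [a [V [dV LV]]] uS sS sf fS /LV Lx.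
have [/LV L0 f0] := fS _ (mem_head _ _).
pose D := [seq gamma s - gamma s0 | s <- S].
have DV : (<<D>> <= V)%VS.
  apply/span_subvP => _ /mapP[s sS' ->].
  have [/LV Ls _] : L (gamma s) /\ f.[s] = 0 by apply: fS; rewrite inE sS' orbT.
  by have := rpredB Ls L0; rewrite opprB addrA subrK.
have VD : V = <<D>>%VS.
  apply/esym/eqP; rewrite eqEdim DV dV /=.
  by have /eqP -> := free_moment_diff uS sS; rewrite size_map.
have : x - gamma s0 \in <<in_tuple D>>%VS.
  by have := rpredB Lx L0; rewrite VD opprB addrA subrK.
move/coord_span/(congr1 (poly_lin f)).
rewrite poly_lin_sum big1 => [|i _].
  by rewrite poly_linB poly_lin_moment // f0 sub0r => /eqP; rewrite subr_eq0 => /eqP.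
have iS : (i < size S)%N.
  by rewrite -(size_map (fun s => gamma s - gamma s0)) ltn_ord.
rewrite /= (nth_map 0) // poly_lin_momentB // f0.
have SiS : S`_i \in s0 :: S by rewrite inE mem_nth ?orbT.
by have [_ ->] := fS _ SiS; rewrite subrr mulr0.
Qed.

(** Such an [f] would give a hyperplane containing [L] with all of [K] strictly on one side, whereas
    [L] meets the hull of [K]. *)
Lemma transversal_not_separated k l (X : {fset 'rV[R]_d}) L s0 S f (K : {fset 'rV[R]_d}) :
    complete_kneser_transversal k l X L ->
    uniq (s0 :: S) -> size S = (d - l)%N -> (size f <= d.+1)%N ->
    (forall s, s \in s0 :: S -> L (gamma s) /\ f.[s] = 0) ->
    (K `<=` X)%fset -> #|` K|%fset = k ->
  ~ (forall p, p \in K -> exists2 t, p = gamma t & 0 < f.[t]).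
Proof.
move=> [pL LK _] uS sS sf fS KX cK pos.
have [x [[w [w0 w1 xE]] Lx]] := LK _ KX cK.
have sSd : (size S <= d)%N by rewrite sS leq_subr.
rewrite -sS in pL.
have := poly_lin_plane pL uS sSd sf fS Lx.
(* A nonnegative combination of the positive values [f.[t]] vanishes, so every weight is zero,
   although the weights sum to 1. *)
rewrite xE poly_lin_sum -[f`_0]mul1r -w1 mulr_suml -sumrN => /eqP.
rewrite -subr_eq0 -sumrB big_seq psumr_eq0 => [/allP wf|p pK]; last first.
  have [t pE ft] := pos p pK; subst p.
  by rewrite poly_lin_moment // mulrBr opprK subrK mulr_ge0 ?w0 // ltW.
suff : \sum_(p <- K) w p = 0 by rewrite w1 => /eqP; rewrite oner_eq0.
rewrite big_seq big1 // => p pK; have := wf p pK; rewrite pK /=.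
have [t pE ft] := pos p pK; subst p.
by rewrite poly_lin_moment // mulrBr opprK subrK mulf_eq0 (gt_eqF ft) orbF => /eqP.
Qed.

End MomentCurve.

(** * Divided differences and alternating points *)

(** The sum is the coefficient of degree [size Q - 1] in the Lagrange interpolant [r] of [p] on [Q];
    this interpolant is [p] itself, whose degree is too small. *)
Lemma divided_difference_eq0 (F : fieldType) (Q : seq F) (p : {poly F}) :
    uniq Q -> (size p < size Q)%N ->
  \sum_(x <- Q) p.[x] / \prod_(y <- Q | y != x) (x - y) = 0.
Proof.
move=> uQ sp.
pose D x := \prod_(y <- Q | y != x) (x - y).
pose N x := \prod_(y <- Q | y != x) ('X - y%:P).
pose r := \sum_(x <- Q) (p.[x] / D x) *: N x.
have sN x : x \in Q -> size (N x) = size Q.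
  move=> xQ; rewrite /N -big_filter size_prod_XsubC size_filter.
  have := count_predC (pred1 x) Q; rewrite (count_uniq_mem _ uQ) xQ add1n.
  by move=> <-.
have D0 x : x \in Q -> D x != 0.
  move=> xQ; rewrite prodf_seq_neq0; apply/allP => y _; apply/implyP => yx.
  by rewrite subr_eq0 eq_sym.
have Nx x z : z \in Q -> z != x -> (N x).[z] = 0.
  move=> zQ zx; rewrite /N horner_prod (big_rem z) //= zx !hornerE subrr.
  by rewrite mul0r.
have rp : r = p.
  apply/eqP; rewrite -subr_eq0; apply/eqP; apply: (roots_geq_poly_eq0 (rs := Q)) => //.
    apply/allP => z zQ; rewrite rootE !hornerE /r horner_sum subr_eq0.
    rewrite (bigD1_seq z) //= big1_seq => [|x /andP[xz _]]; last first.
      by rewrite hornerZ Nx ?mulr0 // eq_sym.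
    rewrite addr0 hornerZ /N horner_prod.
    under eq_bigr do rewrite !hornerE.
    by rewrite divfK // D0.
  rewrite (leq_trans (size_polyD _ _)) // geq_max size_polyN (ltnW sp) andbT.
  rewrite /r big_seq; elim/big_ind : _ => [|a b ha hb|x xQ]; first by rewrite size_poly0.
    by rewrite (leq_trans (size_polyD _ _)) // geq_max ha.
  by rewrite (leq_trans (size_scale_leq _ _)) // sN.
have : r`_(size Q).-1 = 0.
  rewrite rp; apply: nth_default; rewrite -ltnS prednK //.
  exact: leq_ltn_trans (leq0n _) sp.
rewrite /r coef_sum => r0; rewrite -[RHS]r0 !big_seq; apply: eq_bigr => x xQ.
rewrite coefZ -[in RHS](sN x xQ) -[_`_ _ in RHS]/(lead_coef (N x)).
rewrite (monicP (_ : N x \is monic)) ?mulr1 // monic_prod // => y _.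
by rewrite monicXsubC.
Qed.

Lemma sign_prod_sub_gt0 (F : realDomainType) (x : F) (S : seq F) :
  0 < (-1) ^+ odd (count (fun y => x < y) S) * \prod_(y <- S | y != x) (x - y).
Proof.
elim: S => [|z S IH]; first by rewrite big_nil /= mulr1.
rewrite big_cons /= oddD signr_addb oddb.
case: (ltgtP x z) => xz /=; rewrite ?expr0 ?expr1 ?mul1r //.
  by rewrite mulrACA pmulr_rgt0 // mulN1r opprB subr_gt0.
by rewrite mulrCA pmulr_rgt0 // subr_gt0.
Qed.

(** An entry is dropped when it has the parity of its predecessor, and then exceeds it by at least
    2. A kept entry adds 1 to [size w] and at least 1 to the total increase. Either way an entry
    contributes 2 to the right-hand side. *)
Lemma alternating_subseq (x : nat) (s : seq nat) : path ltn x s ->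
  exists w : seq nat, [/\ subseq w s, path (fun a b => odd a != odd b) x w
    & (2 * size s <= size w + (last x s - x))%N].
Proof.
elim: s x => [|y s IH] x /=; first by exists [::].
case/andP=> /= xy /[dup] ps /IH [w [ws pw sw]].
have yl : (y <= last y s)%N.
  have := order_path_min ltn_trans ps; case: (s) => [|a s'] //.
  by move=> /allP/(_ _ (mem_last a s')) /ltnW.
have [oxy|oxy] := eqVneq (odd x) (odd y).
  exists w; split.
  - exact: subseq_trans ws (subseq_cons _ _).
  - by case: w pw {ws sw} => //= a w; rewrite oxy.
  - have {}xy : (x.+1 < y)%N.
      by rewrite ltn_neqAle xy andbT; apply: contraPneq oxy => <- /=; case: odd.
    by move: sw yl; generalize (last y s) (size w) (size s); lia.
exists (y :: w); split => /=.
- by rewrite eqxx.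
- by rewrite oxy.
- lia.
Qed.

Section Hull.
Variables (R : realType) (d : nat).
Local Notation gamma := (@moment_curve R d).

(** Divided-difference weights on at least [d + 2] parameters annihilate every polynomial of degree
    at most [d]. By the parity hypothesis the weights on [u] share a sign, so they normalise to
    convex coefficients. *)
Lemma alternating_hull_meets_plane (b : bool) (u S : seq R) s0 :
    uniq (u ++ s0 :: S) -> (d < size u + size S)%N -> u != [::] ->
    (forall x, x \in u -> odd (count (fun y => x < y) (u ++ s0 :: S)) = b) ->
  exists c : R -> R, [/\ forall x, x \in u -> 0 <= c x, \sum_(x <- u) c x = 1
    & \sum_(x <- u) c x *: gamma x - gamma s0
        \in <<[seq gamma s - gamma s0 | s <- S]>>%VS].
Proof.
set Q := u ++ _ => uQ sQ u0 par.
pose w x := (\prod_(y <- Q | y != x) (x - y))^-1.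
have wu x : x \in u -> 0 < (-1) ^+ b * w x.
  move=> xu; have := sign_prod_sub_gt0 x Q; rewrite par // -invr_gt0 invfM.
  by rewrite invr_sign.
have wE (p : {poly R}) : (size p <= d.+1)%N -> \sum_(x <- Q) w x * p.[x] = 0.
  move=> sp; rewrite -[RHS](divided_difference_eq0 (p := p) uQ).
    by apply: eq_bigr => x _; rewrite mulrC.
  by rewrite size_cat addnS ltnS (leq_trans sp).
have wg : \sum_(x <- Q) w x *: (gamma x - gamma s0) = 0.
  (* Coordinate [i] of [gamma x - gamma s0] is the value at [x] of a polynomial of degree [i + 1],
     at most [d]. *)
  apply/rowP => i; rewrite summxE [RHS]mxE.
  rewrite -[RHS](wE ('X^(i.+1) - (s0 ^+ i.+1)%:P)).
    by apply: eq_bigr => x _; rewrite !mxE !hornerE.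
  rewrite (leq_trans (size_polyD _ _)) // size_polyN size_polyXn geq_max.
  by rewrite ltnS ltn_ord (leq_trans (size_polyC_leq1 _)).
pose W := \sum_(x <- u) (-1) ^+ b * w x.
have W0 : 0 < W.
  rewrite /W; case: (u) u0 wu => // a u' _ wu'.
  rewrite big_cons ltr_wpDr ?wu' ?mem_head //.
  by rewrite big_seq sumr_ge0 // => x xu; rewrite ltW // wu' // inE xu orbT.
pose c x := (-1) ^+ b * w x / W.
have c1 : \sum_(x <- u) c x = 1 by rewrite -mulr_suml divff // gt_eqF.
exists c; split=> // [x xu|]; first by rewrite divr_ge0 ?ltW // wu.
have -> : \sum_(x <- u) c x *: gamma x - gamma s0 =
    ((-1) ^+ b / W) *: \sum_(x <- u) w x *: (gamma x - gamma s0).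
  have {1}-> : gamma s0 = \sum_(x <- u) c x *: gamma s0.
    by rewrite -scaler_suml c1 scale1r.
  rewrite -sumrB scaler_sumr.
  by apply: eq_bigr => x _; rewrite -scalerBr scalerA /c mulrAC.
(* The part of the dependency over [u] is minus the part over [s0 :: S], where the term at [s0] is
   zero. *)
move/eqP: wg; rewrite big_cat addr_eq0 => /eqP -> /=.
rewrite memvZ // rpredN big_cons subrr scaler0 add0r big_seq.
by apply: rpred_sum => s sS; rewrite memvZ // memv_span //; apply: map_f.
Qed.

End Hull.

(** * The lower bound *)

(* The blocks are the intervals between consecutive multiples of (q + r).+1;
   block v holds q items, and block 0 holds r more. *)
Definition block_items (q r j : nat) : seq nat :=
  [seq v * (q + r).+1 + a.+1 | v <- iota 0 j, a <- iota 0 q]%N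
    ++ [seq q + a.+1 | a <- iota 0 r]%N.

Definition separators (q r m : nat) : seq nat :=
  [seq i.+1 * (q + r).+1 | i <- iota 0 m]%N.

Lemma size_block_items q r j : size (block_items q r j) = (q * j + r)%N.
Proof. by rewrite size_cat size_allpairs size_map !size_iota mulnC. Qed.

(** The quotient is the block index; the nonzero remainder tells items from separators. *)
Lemma mem_block_items q r j x : x \in block_items q r j ->
  (0 < j)%N -> (x %/ (q + r).+1 < j)%N /\ (x %% (q + r).+1 != 0)%N.
Proof.
rewrite mem_cat => /orP[/allpairsP[[v a] /= []]|/mapP[a]];
  rewrite !mem_iota /= !add0n.
  move=> vj aq -> _; rewrite divnMDl // modnMDl divn_small ?modn_small ?addn0 //; lia.
by move=> ar -> j0; rewrite divn_small ?modn_small //; lia.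
Qed.

Lemma uniq_block_items q r j : uniq (block_items q r j).
Proof.
have small a : (a < q + r)%N -> (a.+1 < (q + r).+1)%N by [].
rewrite cat_uniq allpairs_uniq ?iota_uniq //= ; last first.
  move=> [v a] [v' a'] /allpairsP[[w c] /= [_ + [-> ->]]].
  rewrite mem_iota add0n => /andP[_ cq] /allpairsP[[w' c'] /= [_ + [-> ->]]].
  rewrite mem_iota add0n => /andP[_ cq'] e.
  have c1 : (c.+1 < (q + r).+1)%N by rewrite small // ltn_addr.
  have c1' : (c'.+1 < (q + r).+1)%N by rewrite small // ltn_addr.
  have := congr1 (modn^~ (q + r).+1) e; have := congr1 (divn^~ (q + r).+1) e.
  by rewrite /= !divnMDl // !modnMDl !divn_small // !modn_small // !addn0 => -> [->].
rewrite map_inj_uniq ?iota_uniq ?andbT => [|a b /addnI[]//].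
apply/hasPn => _ /mapP[a + ->]; rewrite mem_iota /= => ar.
apply/allpairsP => -[[v b] /= []]; rewrite !mem_iota /= => _ bq e.
case: v e => [|v]; lia.
Qed.

Lemma uniq_separators q r m : uniq (separators q r m).
Proof.
by rewrite map_inj_uniq ?iota_uniq // => a b /eqP; rewrite eqn_pmul2r // => /eqP[].
Qed.

Lemma count_leq_iota v m : count (leq v) (iota 0 m) = (m - v)%N.
Proof.
elim: m => // m IH; rewrite -addn1 iotaD count_cat IH /= add0n.
by case: (leqP v m) => vm /=; lia.
Qed.

Lemma count_separators_gt q r m x :
  count (fun y => x < y)%N (separators q r m) = (m - x %/ (q + r).+1)%N.
Proof.
rewrite count_map -count_leq_iota; apply: eq_count => i /=.
by rewrite -ltn_divLR // ltnS.
Qed.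

(** Each step up along [u] lowers the count by one and flips [f], so the combined parity does not
    change. *)
Lemma alternating_parity (f : nat -> bool) u : sorted ltn u ->
    sorted (fun a b => f a != f b) u ->
  exists b, forall x, x \in u -> odd (count (fun y => x < y)%N u) (+) f x = b.
Proof.
case: u => [|x u]; first by exists true.
move=> sx fx; exists (odd (size u) (+) f x).
elim: u x sx fx => [|y u IH] x.
  by move=> _ _ z; rewrite inE => /eqP -> /=; rewrite ltnn.
move=> /[dup] /(order_path_min ltn_trans) xu /andP[xy yu] /andP[fxy fyu] z.
rewrite inE => /predU1P[->|zu].
  rewrite -[count _ _]/((x < x) + count (ltn x) (y :: u))%N ltnn add0n.
  by move: xu; rewrite all_count => /eqP ->.
rewrite -[count _ (x :: _)]/((z < x) + count (ltn z) (y :: u))%N.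
rewrite ltnNge (ltnW (allP xu _ zu)) add0n -[RHS]/(~~ odd (size u) (+) f x).
have := IH y yu fyu z zu; rewrite /= => ->.
by case: (f x) (f y) fxy => -[]; rewrite ?addbT ?addbF ?negbK.
Qed.

Lemma double_beta l j : (0 < l)%N -> odd (j + l) -> (beta l j * 2 = j + l - 1)%N.
Proof.
move=> l0 o; rewrite /beta; apply: divnK; rewrite dvdn2 oddB ?o //.
by rewrite addn_gt0 l0 orbT.
Qed.

(** Pigeonhole: [beta l j] blocks hold at most [beta l j * q + r] items, so [s] meets more blocks
    than that. One representative is taken from each block of an alternating subsequence of their
    indices. *)
Lemma alternating_choice (q r j l : nat) (s : seq nat) :
    (0 < l)%N -> (l < j)%N -> odd (j + l) ->
    uniq s -> {subset s <= block_items q r j} -> (beta l j * q + r < size s)%N ->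
  exists u, [/\ {subset u <= s}, size u = l.+1, sorted ltn u
    & sorted (fun a b => odd (a %/ (q + r).+1) != odd (b %/ (q + r).+1)) u].
Proof.
move=> l0 lj ojl us ss big.
pose M := (q + r).+1.
pose vs : seq nat := [seq v <- iota 0 j | has (fun x => x %/ M == v)%N s].
have svs : (beta l j < size vs)%N.
  rewrite ltnNge; apply/negP => svs; move: big; rewrite ltnNge => /negP; apply.
  suff /(uniq_leq_size us) : {subset s <= [seq v * M + a.+1 | v <- vs, a <- iota 0 q]%N
    ++ [seq q + a.+1 | a <- iota 0 r]%N}.
    rewrite size_cat size_allpairs size_map !size_iota => /leq_trans; apply.
    by rewrite leq_add2r leq_mul2r svs orbT.
  move=> x xs; have := ss x xs; rewrite !mem_cat => /orP[|->]; last by rewrite orbT.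
  case/allpairsP=> -[v a] /= [vj aq xE]; apply/orP; left.
  apply/allpairsP; exists (v, a); split => //=.
  rewrite mem_filter vj andbT; apply/hasP; exists x => //.
  rewrite mem_iota in aq.
  by rewrite xE divnMDl // divn_small ?addn0 // /M; lia.
have ltvs : sorted ltn vs by rewrite sorted_filter ?iota_ltn_sorted //; exact: ltn_trans.
have vsj v : v \in vs -> (v < j)%N by rewrite mem_filter mem_iota => /andP[_ /andP[]].
pose rep (v : nat) : nat := nth 0%N s (find (fun x => x %/ M == v)%N s).
have repP v : v \in vs -> (rep v \in s) /\ (rep v %/ M = v)%N.
  rewrite mem_filter => /andP[hv _]; split; first by rewrite mem_nth // -has_find.
  exact/eqP/(nth_find 0%N hv).
case: vs svs ltvs vsj repP => [|x t] //= sx xt vsj repP.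
have [w [wt pw sw]] := alternating_subseq xt.
have lj' := vsj _ (mem_last x t).
(* Here [2 * beta = j + l - 1], and the block indices increase by at most [j - 1] in total. *)
have lw : (l <= size w)%N.
  have := double_beta l0 ojl.
  by move: sx sw lj'; move: (beta l j) (last x t) (size w) (size t); lia.
have tx : subseq (x :: take l w) (x :: t).
  by rewrite /= eqxx (subseq_trans (take_subseq _ _)).
exists (map rep (x :: take l w)); split.
- by move=> _ /mapP[v /(mem_subseq tx) /repP[vs _] ->].
- by rewrite size_map /= size_takel.
- rewrite sorted_map; apply: (sub_in_sorted (P := mem (x :: t)) (e := ltn)).
  + move=> a b /repP[_ ra] /repP[_ rb] ab; rewrite /relpre /= ltnNge.
    apply/negP => /(leq_div2r M); rewrite ra rb leqNgt => /negP; exact.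
  + by apply/allP => a /(mem_subseq tx).
  + exact: (subseq_sorted ltn_trans tx).
- rewrite sorted_map.
  apply: (sub_in_sorted (P := mem (x :: t)) (e := fun a b => odd a != odd b)).
  + by move=> a b /repP[_ ra] /repP[_ rb]; rewrite /relpre /= ra rb.
  + by apply/allP => a /(mem_subseq tx).
  + exact: take_path pw.
Qed.

Section Lower.
Variables (R : realType) (d : nat).
Local Notation gamma := (@moment_curve R d).
Local Notation natg := (fun x : nat => gamma x%:R).

Lemma cyclic_polytope_fset (T : seq R) : uniq T ->
  cyclic_polytope_vertices (size T) [fset gamma x | x in T]%fset.
Proof.
move=> uT; pose T' := sort <=%R T.
have sT : sorted <%R T' by rewrite sort_lt_sorted.
have szT : size T' = size T by rewrite size_sort.
exists (fun i => T'`_i); split=> [i j ij|].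
  by rewrite (sorted_ltn_nth lt_trans 0 sT) // inE szT.
apply/fsetP => p; apply/imfsetP/imfsetP => /= -[x xT ->].
  have xT' : x \in T' by rewrite mem_sort.
  have ix : (index x T' < size T)%N by rewrite -szT index_mem.
  by exists (Ordinal ix) => //=; rewrite nth_index.
by exists T'`_x => //; rewrite -(mem_sort <=%R) mem_nth ?szT.
Qed.

Lemma card_moment_fset (T : seq R) : (0 < d)%N -> uniq T ->
  #|` [fset gamma x | x in T]%fset | = size T.
Proof.
move=> d0 uT; rewrite card_imfset /=; last exact: moment_curve_inj.
by rewrite undup_id.
Qed.

Lemma in_conv_moment (K : {fset 'rV[R]_d}) (u : seq R) (c : R -> R) :
    (0 < d)%N -> uniq u -> (forall x, x \in u -> gamma x \in K) ->
    (forall x, x \in u -> 0 <= c x) -> \sum_(x <- u) c x = 1 ->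
  in_conv K (\sum_(x <- u) c x *: gamma x).
Proof.
move=> d0 uu uK c0 c1; have ginj := moment_curve_inj (R := R) d0.
(* The first coordinate of [gamma x] is [x], so [p0] recovers the parameter and carries weights from
   parameters to points. *)
pose p0 (p : 'rV[R]_d) := p 0 (Ordinal d0).
have gK x : p0 (gamma x) = x by rewrite /p0 mxE expr1.
pose w p := if p \in [seq gamma x | x <- u] then c (p0 p) else 0.
have sumK (V : nmodType) (F : 'rV[R]_d -> V) :
    (\sum_(p <- K) (if p \in [seq gamma x | x <- u] then F p else 0) =
    \sum_(x <- u) F (gamma x))%R.
  rewrite -big_mkcond -big_filter -(big_map gamma xpredT F); apply: perm_big.
  apply: uniq_perm; rewrite ?filter_uniq ?fset_uniq ?map_inj_uniq // => p.
  by rewrite mem_filter; apply: andb_idr => /mapP[x xu ->]; exact: uK.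
exists w; split.
- by move=> p pK; rewrite /w; case: mapP => // -[x xu ->]; rewrite gK c0.
- by rewrite sumK -[RHS]c1; apply: eq_bigr => x _; rewrite gK.
- under [RHS]eq_bigr do rewrite /w (fun_if (fun a => a *: _)) scale0r.
  by rewrite sumK; apply: eq_bigr => x _; rewrite gK.
Qed.

(** The parameters are natural numbers: the block items and [d - l + 1] separators, whose points
    span the plane. *)
Lemma admits_transversal_blocks k l q r j :
    (0 < l)%N -> (l <= d)%N -> (l < j)%N -> (j <= d - l + 2)%N -> odd (j + l) ->
    k = (beta l j * q + r).+1 ->
  admits_transversal R d k l (d - l + 1 + (q * j + r)).
Proof.
move=> l0 ld lj jd ojl kE.
have d0 : (0 < d)%N by exact: leq_trans ld.
have j0 : (0 < j)%N by exact: leq_ltn_trans lj.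
have ginj : injective natg.
  by move=> x y /(moment_curve_inj d0) /eqP; rewrite eqr_nat => /eqP.
pose P := block_items q r j; pose S := separators q r (d - l).+1.
have SP x : x \in S -> x \notin P.
  case/mapP=> i _ ->; apply/negP => /mem_block_items/(_ j0)[_].
  by rewrite modnMl.
have uT : uniq (P ++ S).
  rewrite cat_uniq uniq_block_items uniq_separators andbT andTb.
  by apply/hasPn => x /SP.
pose X := [fset gamma x | x in [seq x%:R : R | x <- P ++ S]]%fset.
have XE p : p \in X -> exists2 x, x \in P ++ S & p = natg x.
  by case/imfsetP => /= _ /mapP[x xT ->] ->; exists x.
have EX x : x \in P ++ S -> natg x \in X.
  by move=> xT; apply/imfsetP; exists x%:R => //=; apply: map_f.
have Rinj : injective (fun x : nat => x%:R : R).
  by move=> x y /eqP; rewrite eqr_nat => /eqP.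
exists X; split.
  suff <- : size [seq x%:R : R | x <- P ++ S] = (d - l + 1 + (q * j + r))%N.
    by apply: cyclic_polytope_fset; rewrite map_inj_uniq.
  by rewrite size_map size_cat size_block_items size_map size_iota addn1 addnC.
pose M := (q + r).+1.
pose S' := [seq x%:R : R | x <- [seq i.+1 * M | i <- iota 1 (d - l)]%N].
have SE : [seq x%:R : R | x <- S] = M%:R :: S' by rewrite /S /separators /= mul1n.
have uS : uniq (M%:R :: S') by rewrite -SE map_inj_uniq // uniq_separators.
have sS' : size S' = (d - l)%N by rewrite !size_map size_iota.
have frS : free [seq gamma s - gamma M%:R | s <- S'].
  by apply: free_moment_diff => //; rewrite sS' leq_subr.
pose V := <<[seq gamma s - gamma M%:R | s <- S']>>%VS.
pose L z := z - gamma M%:R \in V.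
have LS x : x \in S -> L (natg x).
  move=> /(map_f (fun x : nat => x%:R : R)); rewrite SE inE => /predU1P[->|xS].
    by rewrite /L subrr mem0v.
  by rewrite /L memv_span //; apply/mapP; exists x%:R.
exists L; split.
- exists (gamma M%:R), V; split=> //.
  by have /eqP -> := frS; rewrite size_map.
- move=> K KX cK.
  pose s := [seq x <- P ++ S | natg x \in K].
  have us : uniq s by rewrite filter_uniq.
  have Ks : perm_eq K [seq natg x | x <- s].
    apply: uniq_perm; rewrite ?fset_uniq ?map_inj_uniq // => p.
    apply/idP/mapP => [pK|[x]]; last by rewrite mem_filter => /andP[+ _] ->.
    have [x xT pE] := XE p (fsubsetP KX p pK).
    by exists x => //; rewrite mem_filter xT andbT -pE.
  have ss : size s = k.
    by rewrite -cK -(size_map natg) -(perm_size Ks).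
  (* A subset containing a separator meets [L] at that point; otherwise all its elements are block
     items. *)
  have [/hasP[x xs xS]|nS] := boolP (has (mem S) s).
    exists (natg x); split; last exact: LS.
    have := @in_conv_moment K [:: x%:R] (fun=> 1) d0 isT.
    rewrite !big_cons !big_nil scale1r !addr0; apply=> // y.
    by rewrite inE => /eqP ->; move: xs; rewrite mem_filter => /andP[].
  have sP : {subset s <= P}.
    move=> x xs; have := hasPn nS x xs; move: xs; rewrite mem_filter mem_cat.
    by case/andP => _ /orP[//|xS]; rewrite [mem S x]xS.
  have [|u [us' su ltu altu]] := alternating_choice l0 lj ojl us sP.
    by rewrite ss kE.
  have [b par] := alternating_parity ltu altu.
  have uP x : x \in u -> x \in P by move=> /us' /sP.
  have uS' : uniq ([seq x%:R : R | x <- u] ++ M%:R :: S').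
    rewrite -SE -map_cat map_inj_uniq // cat_uniq uniq_separators.
    rewrite (sorted_uniq ltn_trans ltnn ltu) andbT andTb.
    by apply/hasPn => x /SP; apply: contra => /uP.
  have szQ : (d < size [seq x%:R : R | x <- u] + size S')%N.
    by rewrite size_map su sS'; lia.
  have u0 : [seq x%:R : R | x <- u] != [::] by case: (u) su.
  have parQ x : x \in [seq x%:R : R | x <- u] ->
      odd (count (fun y => x < y) ([seq x%:R | x <- u] ++ M%:R :: S'))
        = odd (d - l).+1 (+) b.
    case/mapP=> {}x xu ->; rewrite -SE -map_cat count_map.
    under eq_count do rewrite /= ltr_nat.
    (* The number of separators above [x] is [(d - l).+1] minus the block index; [j <= d - l + 2]
       keeps this truncated subtraction exact, so its parity can be split. *)
    have vle : (x %/ (q + r).+1 <= (d - l).+1)%N.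
      have [vj _] := mem_block_items (uP _ xu) j0.
      by rewrite -ltnS (leq_trans vj) // -addn2.
    rewrite count_cat count_separators_gt oddD oddB //.
    by rewrite -(par x xu) addbCA.
  have [c [c0 c1 cL]] := alternating_hull_meets_plane uS' szQ u0 parQ.
  exists (\sum_(x <- [seq x%:R | x <- u]) c x *: gamma x); split=> //.
  apply: in_conv_moment => //; first by move: uS'; rewrite cat_uniq => /andP[].
  by move=> _ /mapP[x /us' + ->]; rewrite mem_filter => /andP[].
- exists [fset gamma x | x in [seq x%:R : R | x <- S]]%fset; split.
  + apply/fsubsetP => p; case/imfsetP => _ /mapP[x xS ->] ->.
    by rewrite EX // mem_cat xS orbT.
  + rewrite card_moment_fset //; last by rewrite map_inj_uniq // uniq_separators.
    by rewrite !size_map size_iota.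
  + by move=> p; case/imfsetP => _ /mapP[x xS ->] ->; apply: LS.
Qed.
End Lower.

(** * The upper bound *)

Section CyclicGaps.
Variable R : realType.
Implicit Types (S P : seq R) (t : R).

(* Gap p lies between the p-th and the next entry of S; the last gap joins
   both unbounded intervals. *)
Definition cyclic_gap S t : nat :=
  ((count (fun y => (y < t)%R) S + (size S).-1) %% size S)%N.

Lemma nth_lt_count S t p : sorted <%R S -> (p < size S)%N ->
  (S`_p < t) = (p < count (fun y => (y < t)%R) S)%N.
Proof.
elim: S p => // x S IH [|p] sS pS /=.
  case: ltP => //= tx; rewrite add0n; apply/esym/negbTE; rewrite -leqNgt leqn0.
  rewrite -[_ == _]negbK -lt0n -has_count; apply/hasPn => y yS; rewrite -leNgt.
  by rewrite (le_trans tx) // ltW // (allP (order_path_min lt_trans sS)).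
rewrite IH //; last exact: path_sorted sS.
case: (ltP x t) => //= tx; rewrite add0n.
suff -> : count (fun y => y < t) S = 0%N by [].
apply/eqP; rewrite -[_ == _]negbK -lt0n -has_count; apply/hasPn => y yS.
by rewrite -leNgt (le_trans tx) // ltW // (allP (order_path_min lt_trans sS)).
Qed.

(** Outside an ordinary gap, [t] has both ends on the same side. The last gap wraps around: a point
    outside it lies between its ends, the last and first entries of [S], hence the extra sign. *)
Lemma cyclic_gap_sign S t p : sorted <%R S -> (1 < size S)%N -> t \notin S ->
    (p < size S)%N -> p != cyclic_gap S t ->
  0 < (-1) ^+ (p == (size S).-1) * ((t - S`_p) * (t - S`_(p.+1 %% size S))).
Proof.
move=> sS S1 tS pS; rewrite /cyclic_gap.
have dist i : (i < size S)%N -> 0 < `|t - S`_i|.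
  by move=> iS; rewrite normr_gt0 subr_eq0; apply: contraNneq tS => ->; rewrite mem_nth.
have sgn i : (i < size S)%N ->
    t - S`_i = (-1) ^+ (count (fun y => (y < t)%R) S <= i)%N * `|t - S`_i|.
  move=> iS; rewrite leqNgt -nth_lt_count //; case: ltP => h /=.
    by rewrite mul1r gtr0_norm // subr_gt0.
  by rewrite mulN1r ler0_norm ?opprK // subr_le0.
have cS := count_size (fun y => y < t) S.
rewrite (sgn p pS).
have [pl|pl] := eqVneq p (size S).-1.
  rewrite pl prednK ?modnn; last exact: ltnW.
  rewrite (sgn 0%N (ltnW S1)).
  move: cS; set n := count _ _ => cS.
  have [->|nS] := eqVneq n (size S).
    by rewrite modnDl modn_small ?eqxx // ltn_predL ltnW.
  have [->|n00] := eqVneq n 0%N.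
    by rewrite add0n modn_small ?eqxx // ltn_predL ltnW.
  rewrite leqn0 (negbTE n00) -ltnS (prednK (ltnW S1)) ltn_neqAle nS cS.
  move=> _; rewrite expr0 !expr1 mul1r !mulN1r mulNr opprK -pl.
  by rewrite mulr_gt0 // dist // ltnW.
have p1S : (p.+1 < size S)%N.
  by rewrite -ltn_predRL ltn_neqAle pl -ltnS prednK ?pS // ltnW.
rewrite (modn_small p1S); rewrite (sgn p.+1 p1S).
move: cS; set n := count _ _ => cS.
have [->|np] := eqVneq n p.+1.
  rewrite addSn -addnS prednK ?modnDr ?modn_small ?eqxx //; exact: ltnW.
have -> : (n <= p.+1)%N = (n <= p)%N by lia.
by move=> _; rewrite mul1r mulrACA -signr_addb addbb mul1r mulr_gt0 ?dist.
Qed.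

(** The test that [t] is kept for the shift [i]. When [2 * e <= size S], the discarded gaps have
    pairwise disjoint pairs of ends. *)
Definition avoids_gaps S i e t : bool :=
  all (fun a => cyclic_gap S t != (i + 2 * a) %% size S)%N (iota 0 e).

Lemma exists_separating_poly S (big : R) (o : bool) e i :
    let S' := S ++ nseq o big in
    sorted <%R S' -> (1 < size S')%N -> (2 * e <= size S')%N ->
  exists f : {poly R}, [/\ (size f <= (size S + (size S' - 2 * e)).+1)%N,
    forall s, s \in S -> f.[s] = 0
    & forall t, t \notin S' -> t < big -> avoids_gaps S' i e t -> 0 < f.[t]].
Proof.
move=> S' sS' S1 eS; set c := size S' in S1 eS *.
have c0 : (0 < c)%N := ltnW S1.
(* [y] lists the cut points cyclically from [i]: the ends of the discarded gaps come first, in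
   consecutive pairs, and the indices from [2 * e] on give the remaining cut points. *)
pose y b := S'`_((i + b) %% c).
(* This sign corrects the pair of ends when the discarded gap is the one that wraps around. *)
pose sg a : R := (-1) ^+ ((i + 2 * a) %% c == c.-1)%N.
pose f := ((-1) ^+ o * \prod_(a < e) sg a) *:
  (\prod_(x <- S) ('X - x%:P) * \prod_(2 * e <= b < c) ('X - (y b)%:P)).
exists f; split.
- rewrite (leq_trans (size_scale_leq _ _)) // (leq_trans (size_polyMleq _ _)) //.
  rewrite size_prod_XsubC -(big_map y xpredT (fun z => 'X - z%:P)) size_prod_XsubC.
  by rewrite size_map size_iota addnS.
- move=> s sS; rewrite hornerZ hornerM.
  have /rootP -> : root (\prod_(x <- S) ('X - x%:P)) s by rewrite root_prod_XsubC.
  by rewrite mul0r mulr0.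
move=> t tS tbig gaps.
have ty b : t - y b != 0.
  by rewrite subr_eq0; apply: contraNneq tS => ->; rewrite mem_nth // ltn_mod.
have rotE : \prod_(x <- S') (t - x) = \prod_(0 <= b < c) (t - y b).
  rewrite (big_nth 0) -/c /y; case: (c) c0 => // c' _; rewrite !big_mkord.
  rewrite (reindex_inj (addrI (inord (i %% c'.+1)))) /=.
  by apply: eq_bigr => b _; rewrite inordK ?ltn_mod // modnDml.
have pairs n : \prod_(0 <= b < 2 * n) (t - y b) =
    \prod_(a < n) ((t - y (2 * a)%N) * (t - y (2 * a).+1)).
  elim: n => [|n IH]; first by rewrite muln0 big_nil big_ord0.
  by rewrite mulnS !addSn add0n !big_nat_recr //= IH big_ord_recr /= mulrA.
have tailE : \prod_(x <- S') (t - x) =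
    \prod_(x <- S) (t - x) * (-1) ^+ o * (big - t) ^+ o.
  rewrite big_cat; case: (o) => /=; last by rewrite big_nil !mulr1.
  by rewrite big_seq1 !expr1 mulrN1 mulNr -mulrN opprB.
have o0 : 0 < (big - t) ^+ o by rewrite exprn_gt0 // subr_gt0.
(* The positive factor [(big - t) ^+ o] completes, up to the sign [(-1) ^+ o], the product over [S]
   to one over [S']. The ends of discarded gaps then pair up, and the remaining factors form a
   square. *)
rewrite -(pmulr_rgt0 _ o0) hornerZ hornerM !horner_prod.
under eq_bigr do rewrite !hornerE.
under [\prod_(_ <= _ < _) _]eq_bigr do rewrite !hornerE.
rewrite [X in 0 < X](_ : _ =
   \prod_(a < e) (sg a * ((t - y (2 * a)%N) * (t - y (2 * a).+1))) *
   (\prod_(2 * e <= b < c) (t - y b)) ^+ 2).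
  rewrite mulr_gt0 //; last first.
    by rewrite exprn_even_gt0 //= prodf_seq_neq0; apply/allP => b _; exact: ty.
  apply: prodr_gt0 => a _.
  have -> : y (2 * a).+1 = S'`_(((i + 2 * a) %% c).+1 %% c).
    by rewrite /y -[(_ %% c).+1]addn1 modnDml addn1 addnS.
  apply: cyclic_gap_sign => //; first by rewrite ltn_mod.
  by rewrite eq_sym (allP gaps) // mem_iota /=.
rewrite big_split /= -pairs expr2 [X in _ = X]mulrA.
rewrite -[X in _ = X * _]mulrA -big_cat_nat //.
rewrite -rotE tailE.
by ring.
Qed.

(** Double counting: for each [a < e], the gap of [t] determines the shift at which it is discarded,
    so [t] is lost for at most [e] shifts. *)
Lemma sum_avoids_gaps S P e :
  ((size S - e) * size P <= \sum_(i < size S) size [seq t <- P | avoids_gaps S i e t])%N.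
Proof.
have one t a : (\sum_(i < size S) (cyclic_gap S t == (i + 2 * a) %% size S) <= 1)%N.
  rewrite (_ : (\sum_(i < _) _)%N =
    #|[pred i : 'I_(size S) | cyclic_gap S t == (i + 2 * a) %% size S]%N|).
    apply/card_le1_eqP => i j; rewrite !inE => /eqP -> /eqP.
    by move/eqP; rewrite eqn_modDr !modn_small // => /eqP/val_inj.
  rewrite -sum1_card [RHS]big_mkcond; apply: eq_bigr => i _.
  by rewrite inE; case: (_ == _).
have avoid t : (size S - e <= \sum_(i < size S) avoids_gaps S i e t)%N.
  rewrite leq_subLR.
  suff : (\sum_(i < size S) ~~ avoids_gaps S i e t <= e)%N.
    rewrite -(leq_add2r (\sum_(i < size S) avoids_gaps S i e t)) -big_split /=.
    under eq_bigr do rewrite addn_negb.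
    by rewrite sum1_card card_ord.
  apply: (@leq_trans (\sum_(a < e) \sum_(i < size S)
    (cyclic_gap S t == (i + 2 * a) %% size S))%N).
    rewrite exchange_big; apply: leq_sum => i _.
    rewrite /avoids_gaps -has_predC; case: hasP => //= -[a].
    rewrite mem_iota add0n /= => ae.
    by rewrite negbK => h; rewrite (bigD1 (Ordinal ae)) //= h.
  rewrite -[leqRHS]card_ord -sum1_card; apply: leq_sum => a _; exact: one.
elim: P => [|t P IH]; first by rewrite muln0.
rewrite mulnS (leq_trans (leq_add (avoid t) IH)) // -big_split leq_sum // => i _ /=.
by case: ifP.
Qed.
End CyclicGaps.

Section Upper.
Variables (R : realType) (d : nat).
Local Notation gamma := (@moment_curve R d).

Lemma cyclic_polytope_sorted n (X : {fset 'rV[R]_d}) : cyclic_polytope_vertices n X ->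
  exists T : seq R, [/\ sorted <%R T, size T = n & X = [fset gamma x | x in T]%fset].
Proof.
case=> t [tlt ->]; have tinj : injective t.
  move=> i j tij; apply/val_inj/eqP; case: ltngtP => // /tlt; by rewrite tij ltxx.
exists (sort <=%R [seq t i | i <- enum 'I_n]); split.
- by rewrite sort_lt_sorted map_inj_uniq ?enum_uniq.
- by rewrite size_sort size_map size_enum_ord.
apply/fsetP => p; apply/imfsetP/imfsetP => /= -[x xT ->].
  by exists (t x) => //; rewrite mem_sort map_f ?mem_enum.
by move: xT; rewrite mem_sort => /mapP[i _ ->]; exists i.
Qed.

Lemma exists_strict_upper_bound (T : seq R) : exists b, forall x, x \in T -> x < b.
Proof.
elim: T => [|x T [b bT]]; first by exists 0.
exists (Num.max b (x + 1)) => y; rewrite inE lt_max => /predU1P[->|/bT -> //].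
by rewrite ltrDl ltr01 orbT.
Qed.

Lemma admits_transversal_upper k l n :
    (0 < k)%N -> (0 < l)%N -> (l <= d)%N -> (l <= uphalf d)%N ->
    admits_transversal R d k l n ->
  (d - l + 1 <= n)%N /\
  (uphalf d * (n - (d - l + 1)) <= (2 * uphalf d - l + 1) * (k - 1))%N.
Proof.
move=> k0 l0 ld lh [X [/cyclic_polytope_sorted [T [sT szT ->]] [L trL]]].
have d0 : (0 < d)%N by exact: leq_trans ld.
have [_ _ [Y [YX cY LY]]] := trL.
have ginj := moment_curve_inj (R := R) d0.
have uT := sorted_uniq lt_trans ltxx sT.
pose S := [seq x <- T | gamma x \in Y].
have szS : size S = (d - l).+1.
  rewrite -cY -(size_map gamma); apply/esym/perm_size/uniq_perm;
    rewrite ?fset_uniq ?map_inj_uniq ?filter_uniq // => p.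
  apply/idP/mapP => [pY|[x]]; last by rewrite mem_filter => /andP[+ _] ->.
  have := fsubsetP YX p pY; case/imfsetP => x /= xT pE.
  by exists x => //; rewrite mem_filter xT andbT -pE.
have sS : sorted <%R S by exact: sorted_filter lt_trans _ _ sT.
have [big bigT] := exists_strict_upper_bound T.
(* For odd [d] the extra cut point [big] brings the number of cut points to [2 * uphalf d - l + 1],
   the same formula as for even [d]. *)
pose S' := S ++ nseq (odd d) big.
pose P := [seq x <- T | gamma x \notin Y].
have szP : (size P = n - (d - l + 1))%N.
  rewrite -szT addn1 -szS !size_filter.
  by rewrite -(count_predC (fun x => gamma x \in Y) T) addKn.
have dE : (uphalf d * 2 = d + odd d)%N.
  by rewrite uphalf_half; have := odd_double_half d; lia.
have szS' : size S' = (2 * uphalf d - l + 1)%N by rewrite size_cat size_nseq szS; lia.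
pose e := (uphalf d - l + 1)%N.
have sS' : sorted <%R S'.
  move: sS; rewrite !lt_sorted_pairwise pairwise_cat => ->.
  rewrite (_ : pairwise _ (nseq _ _)) ?andbT; last by case: (odd d).
  apply/allrelP => x y xS; rewrite mem_nseq => /andP[_ /eqP ->].
  by apply: bigT; move: xS; rewrite mem_filter => /andP[].
split; first by rewrite addn1 -szS -szT size_filter count_size.
have eS' : (2 * e <= size S')%N by lia.
have S'1 : (1 < size S')%N by lia.
(* Otherwise [k] kept points would form a subset strictly separated from [L]. *)
have kept i : (size [seq t <- P | avoids_gaps S' i e t] <= k - 1)%N.
  rewrite leqNgt; apply/negP => kP.
  have [f [sf fS fpos]] := exists_separating_poly (e := e) i sS' S'1 eS'.
  pose u := take k [seq t <- P | avoids_gaps S' i e t].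
  have uu : uniq u by rewrite take_uniq // !filter_uniq.
  have su : size u = k by rewrite size_takel //; lia.
  have uP t : t \in u -> [/\ t \in T, gamma t \notin Y & avoids_gaps S' i e t].
    by move/mem_take; rewrite !mem_filter => /andP[-> /andP[-> ->]].
  have KX : ([fset gamma t | t in u] `<=` [fset gamma x | x in T])%fset.
    apply/fsubsetP => p; case/imfsetP => t /= /uP[tT _ _] ->.
    by apply/imfsetP; exists t.
  have cK : #|` [fset gamma t | t in u]%fset| = k by rewrite card_moment_fset.
  case ES : S => [|s0 S0]; first by rewrite ES in szS.
  have [] // := transversal_not_separated (s0 := s0) (S := S0) (f := f) trL _ _ _ _ KX cK.
  + by rewrite -ES filter_uniq.
  + by move: szS; rewrite ES => -[].
  (* The degree is at most [d - l + 1] from [S] plus [size S' - 2 * e = l - 1] from the remaining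
     cut points, in total [d]. *)
  + by rewrite (leq_trans sf) // ltnS szS szS' /e; lia.
  + move=> s; rewrite -ES => sS0; split; last exact: fS.
    by apply: LY; move: sS0; rewrite mem_filter => /andP[].
  + move=> p; case/imfsetP => t /= /uP[tT tY gt] ->; exists t => //.
    apply: fpos => //; last exact: bigT.
    rewrite mem_cat negb_or mem_filter negb_and tY /= mem_nseq negb_and.
    by rewrite (lt_eqF (bigT _ tT)) orbT.
have := sum_avoids_gaps S' P e.
have -> : (size S' - e = uphalf d)%N by lia.
rewrite szP szS' => /leq_trans; apply.
apply: (@leq_trans (\sum_(i < 2 * uphalf d - l + 1) (k - 1))%N).
  by apply: leq_sum => i _; exact: kept.
by rewrite sum_nat_const card_ord.
Qed.

End Upper.

(** * Comparison with the stated bounds and existence of the maximum *)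

Lemma alpha_lt1_leq d l : (0 < d)%N -> alpha d l < 1 -> (l <= uphalf d)%N.
Proof.
move=> d0; have h0 : (0 < uphalf d)%N by case: d d0 => // -[].
by rewrite /alpha ltr_pdivrMr ?ltr0n // mul1r ltrBlDr natr1 ltr_nat ltnS.
Qed.

(** With [h = uphalf d], [h * (2 - alpha d l)] equals [2 * h - l + 1]; dividing the counting
    inequality by [h] and using integrality gives the floor. *)
Lemma leq_Z_bound k d l n : (0 < k)%N -> (0 < d)%N -> (0 < l)%N -> (l <= uphalf d)%N ->
    (d - l + 1 <= n)%N ->
    (uphalf d * (n - (d - l + 1)) <= (2 * uphalf d - l + 1) * (k - 1))%N ->
  n%:Z <= Z_bound k d l.
Proof.
move=> k0 d0 l0 lh mn; have h0 : (0 < uphalf d)%N by case: d d0 {lh mn} => // -[].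
rewrite /Z_bound -lerBlDl subzn // -(ler_nat rat) !natrM => H.
rewrite floor_ge_int -pmulrn /alpha -(ler_pM2l (x := (uphalf d)%:R)) ?ltr0n //.
apply: (le_trans H); rewrite natrD natrB ?natrM ?natrB //; last by lia.
have hn0 : (uphalf d)%:R != 0 :> rat by rewrite pnatr_eq0 -lt0n.
by rewrite le_eqVlt; apply/orP; left; apply/eqP; field.
Qed.

(** The index [j = l + 1] is admissible because [2 * l <= d + 1], so the maximum is reached at some
    index and is not the default 0 of an empty range. *)
Lemma z_bound_attained k d l : (l <= d)%N -> (l <= uphalf d)%N ->
  exists j, [/\ (l < j)%N, (j <= d - l + 2)%N, odd (j + l) &
    z_bound k d l = (d - l + 1 + ((k - 1) %/ beta l j * j + (k - 1) %% beta l j))%N].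
Proof.
move=> ld lh; rewrite /z_bound.
pose F j := ((k - 1) %/ beta l j * j + (k - 1) %% beta l j)%N.
have : (0 < #|[pred j : 'I_(d - l + 2).+1 | odd (j + l) && (l < j)%N]|)%N.
  have lj : (l.+1 < (d - l + 2).+1)%N.
    by have := odd_double_half d; rewrite uphalf_half in lh; lia.
  by apply/card_gt0P; exists (Ordinal lj); rewrite inE /= ltnSn oddD addbb.
move=> /(eq_bigmax_cond (fun j : 'I__ => F j)) [j]; rewrite inE => /andP[oj lj] maxE.
exists j; split=> //; first by rewrite -ltnS.
by congr (_ + _)%N; rewrite big_geq_mkord addn1; exact: maxE.
Qed.

Theorem theorem6 (R : realType) (k d l : nat)
    (hk : (0 < k)%N) (hd : (0 < d)%N) (hl : (0 < l)%N)
    (hdl : (l <= d)%N) (hkl : (l + 1 <= k)%N) (halpha : alpha d l < 1) :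
  exists zeta : nat,
    is_zeta R k d l zeta /\
    (z_bound k d l)%:Z <= zeta%:Z <= Z_bound k d l.
Proof.
have lh := alpha_lt1_leq hd halpha.
pose p n := `[< admits_transversal R d k l n >].
have pz : p (z_bound k d l).
  have [j [lj jd ojl ->]] := z_bound_attained k hdl lh.
  (* Here [q] and [r] are the quotient and remainder of [k - 1] by [beta l j]. *)
  apply/asboolP; apply: admits_transversal_blocks => //.
  by rewrite mulnC -divn_eq subn1 prednK.
have pZ n : p n -> n%:Z <= Z_bound k d l.
  move=> /asboolP /(admits_transversal_upper hk hl hdl lh) [mn hn].
  exact: leq_Z_bound.
(* The absolute value turns the integer bound into a natural one; with the member [pz], a largest
   admissible [n] exists. *)
have pub n : p n -> (n <= `|Z_bound k d l|)%N by move/pZ; lia.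
case: (ex_maxnP (ex_intro (fun n => p n) _ pz) pub) => zeta pzeta zmax.
exists zeta; split; last by rewrite pZ // lez_nat zmax.
by split=> [|n /asboolP /zmax //]; apply/asboolP.
Qed.
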